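(* Consider $\mathcal{G}$ as a complete-join-semilattice-enriched $\dagger$-compact closed category with the structure described below. Then $\mathrm{CPM}(\mathbf{Rel})$ and $\mathcal{G}$ are isomorphic as complete-join-semilattice-enriched $\dagger$-compact closed categories.
   Context: $\mathbf{Rel}$: sets and binary relations, dagger the converse relation; a relation $P: X\to X$ is positive if $P=T^\dagger\circ T$ for some relation $T: X\to Y$. $\mathrm{CPM}(\mathbf{Rel})$ has sets as objects; a morphism $A\to B$ is a relation $R\subseteq(A\times A)\times(B\times B)$ such that the relation $\overline{R}$ on $A\times B$, $\overline{R}((a_1,b_1),(a_2,b_2))\iff R(a_2,a_1,b_2,b_1)$, is positive; composition $(S\circ R)(a,a',c,c')\iff\exists b,b'.\ R(a,a',b,b')\wedge S(b,b',c,c')$, identity $1_A(a_1,a_2,a_3,a_4)\iff a_1=a_3\wedge a_2=a_4$. Its structure: tensor on objects is cartesian product and $(R\otimes S)((a,b),(a',b'),(c,d),(c',d'))\iff R(a,a',c,c')\wedge S(b,b',d,d')$ for $R: A\to C$, $S: B\to D$; dagger $R^\dagger(b,b',a,a')\iff R(a,a',b,b')$; symmetry, unit, cups and caps are the images $h\otimes h$ of those of $\mathbf{Rel}$ (cartesian product, self-dual objects with cup $\{( *,(a,a))\}$) under $h\mapsto h\otimes h$; homsets ordered by inclusion of relations (complete join semilattices, joins = unions). A graph is a vertex set $W$ with a set $E$ of unordered pairs $\{v,w\}$ of vertices ($v=w$ allowed) with $\{v\}\in E$ for every $v\in W$; write $V(\gamma),E(\gamma)$. The category $\mathcal{G}$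 has sets as objects; a morphism $\gamma: A\to B$ is a graph with vertex set a subset of $A\times B$; composition: $V(\gamma'\circ\gamma)=\{(a,c)\mid\exists b.\ (a,b)\in V(\gamma)\wedge(b,c)\in V(\gamma')\}$, $E(\gamma'\circ\gamma)=\{\{(a,c),(a',c')\}\mid\exists b,b'.\ \{(a,b),(a',b')\}\in E(\gamma)\wedge\{(b,c),(b',c')\}\in E(\gamma')\}$; identity $1_A$ is the complete graph on $\{(a,a)\mid a\in A\}$. Tensor: on objects cartesian product; for $\gamma: A\to C$, $\gamma': B\to D$, $\gamma\otimes\gamma': A\times B\to C\times D$ has vertices $\{(a,b,c,d)\mid (a,c)\in V(\gamma)\wedge(b,d)\in V(\gamma')\}$ and edges $\{\{(a,b,c,d),(a',b',c',d')\}\mid \{(a,c),(a',c')\}\in E(\gamma)\wedge\{(b,d),(b',d')\}\in E(\gamma')\}$. Order: $\gamma\le\gamma'\iff E(\gamma)\subseteq E(\gamma')$, with joins given by unions of vertex and edge sets. Dagger: identity on objects, $V(\gamma^\dagger)=\{(b,a)\mid(a,b)\in V(\gamma)\}$, $E(\gamma^\dagger)=\{\{(b,a),(b',a')\}\mid\{(a,b),(a',b')\}\in E(\gamma)\}$. Symmetry $A\otimes B\to B\otimes A$: complete graph on $\{((a,b),(b,a))\mid a\in A,b\in B\}$. Cup $\{*\}\to A\otimes A$: complete graph on $\{( *,(a,a))\mid a\in A\}$; cap is its dagger; every object is self-dual. *)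

(* Defs.v *)
From mathcomp Require Import all_boot.
From mathcomp Require Import boolp classical_sets.

Set Implicit Arguments.
Unset Strict Implicit.
Unset Printing Implicit Defensive.

Local Open Scope classical_set_scope.

Declare Scope edcc_scope.
Delimit Scope edcc_scope with edcc.
Reserved Notation "A \ox B" (at level 40, left associativity).
Reserved Notation "f \oxm g" (at level 40, left associativity).
Reserved Notation "f ^dag" (at level 1, format "f ^dag").

Record edcc_data := EdccData {
  obj : Type;
  hom : obj -> obj -> Type;
  idm : forall A, hom A A;
  comp : forall A B C, hom B C -> hom A B -> hom A C;
  unit_obj : obj;
  tens : obj -> obj -> obj;
  tensm : forall A B C D, hom A C -> hom B D -> hom (tens A B) (tens C D);
  assoc : forall A B C, hom (tens (tens A B) C) (tens A (tens B C));
  lunit : forall A, hom (tens unit_obj A) A;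
  runit : forall A, hom (tens A unit_obj) A;
  sym : forall A B, hom (tens A B) (tens B A);
  dag : forall A B, hom A B -> hom B A;
  dual : obj -> obj;
  cup : forall A, hom unit_obj (tens (dual A) A);
  cap : forall A, hom (tens A (dual A)) unit_obj;
  le : forall A B, hom A B -> hom A B -> Prop;
  sup : forall A B, set (hom A B) -> hom A B }.

Arguments idm {e} A.
Arguments unit_obj {e}.
Arguments assoc {e} A B C.
Arguments lunit {e} A.
Arguments runit {e} A.
Arguments sym {e} A B.
Arguments cup {e} A.
Arguments cap {e} A.

Notation "g \o f" := (comp g f) : edcc_scope.
Notation "A \ox B" := (tens A B) : edcc_scope.
Notation "f \oxm g" := (tensm f g) : edcc_scope.
Notation "f ^dag" := (dag f) : edcc_scope.

Local Open Scope edcc_scope.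

Record is_category (C : edcc_data) : Prop := IsCategory {
  compA : forall (A B D E : obj C) (h : hom D E) (g : hom B D) (f : hom A B),
    h \o (g \o f) = (h \o g) \o f;
  comp1m : forall (A B : obj C) (f : hom A B), idm B \o f = f;
  compm1 : forall (A B : obj C) (f : hom A B), f \o idm A = f }.

Record is_dagger (C : edcc_data) : Prop := IsDagger {
  dagK : forall (A B : obj C) (f : hom A B), f^dag^dag = f;
  dag1 : forall A : obj C, (idm A)^dag = idm A;
  dagM : forall (A B D : obj C) (g : hom B D) (f : hom A B),
    (g \o f)^dag = f^dag \o g^dag }.

(* Symmetric monoidal, the dagger being monoidal and the structural
   isomorphisms unitary; unitarity also makes them invertible. *)
Record is_dagger_symmetric_monoidal (C : edcc_data) : Prop :=
  IsDaggerSymmetricMonoidal {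
  tens1 : forall A B : obj C, idm A \oxm idm B = idm (A \ox B);
  tensM : forall (A B D A' B' D' : obj C) (g : hom B D) (f : hom A B)
      (g' : hom B' D') (f' : hom A' B'),
    (g \o f) \oxm (g' \o f') = (g \oxm g') \o (f \oxm f');
  tens_dag : forall (A B D E : obj C) (f : hom A D) (g : hom B E),
    (f \oxm g)^dag = f^dag \oxm g^dag;
  assoc_nat : forall (A B D A' B' D' : obj C) (f : hom A A') (g : hom B B')
      (h : hom D D'),
    assoc A' B' D' \o ((f \oxm g) \oxm h)
    = (f \oxm (g \oxm h)) \o assoc A B D;
  lunit_nat : forall (A A' : obj C) (f : hom A A'),
    lunit A' \o (idm unit_obj \oxm f) = f \o lunit A;
  runit_nat : forall (A A' : obj C) (f : hom A A'),
    runit A' \o (f \oxm idm unit_obj) = f \o runit A;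
  sym_nat : forall (A B A' B' : obj C) (f : hom A A') (g : hom B B'),
    sym A' B' \o (f \oxm g) = (g \oxm f) \o sym A B;
  assocK : forall A B D : obj C, (assoc A B D)^dag \o assoc A B D = idm _;
  assocVK : forall A B D : obj C, assoc A B D \o (assoc A B D)^dag = idm _;
  lunitK : forall A : obj C, (lunit A)^dag \o lunit A = idm _;
  lunitVK : forall A : obj C, lunit A \o (lunit A)^dag = idm _;
  runitK : forall A : obj C, (runit A)^dag \o runit A = idm _;
  runitVK : forall A : obj C, runit A \o (runit A)^dag = idm _;
  symK : forall A B : obj C, sym B A \o sym A B = idm _;
  sym_dag : forall A B : obj C, (sym A B)^dag = sym B A;
  pentagon : forall A B D E : obj C,
    assoc A B (D \ox E) \o assoc (A \ox B) D E
    = (idm A \oxm assoc B D E)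
      \o (assoc A (B \ox D) E \o (assoc A B D \oxm idm E));
  triangle : forall A B : obj C,
    (idm A \oxm lunit B) \o assoc A unit_obj B = runit A \oxm idm B;
  hexagon : forall A B D : obj C,
    assoc B D A \o (sym A (B \ox D) \o assoc A B D)
    = (idm B \oxm sym A D) \o (assoc B A D \o (sym A B \oxm idm D)) }.

Record is_compact (C : edcc_data) : Prop := IsCompact {
  cap_dag : forall A : obj C, cap A = (cup A)^dag \o sym A (dual A);
  snake : forall A : obj C,
    lunit A \o ((cap A \oxm idm A) \o ((assoc A (dual A) A)^dag
      \o ((idm A \oxm cup A) \o (runit A)^dag))) = idm A;
  snake_dual : forall A : obj C,
    runit (dual A) \o ((idm (dual A) \oxm cap A) \o (assoc (dual A) A (dual A)
      \o ((cup A \oxm idm (dual A)) \o (lunit (dual A))^dag)))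
    = idm (dual A) }.

(* The hom-posets are complete join semilattices, and composition, tensor and
   dagger preserve arbitrary (also empty) joins in each variable. *)
Record is_sup_enriched (C : edcc_data) : Prop := IsSupEnriched {
  le_refl : forall (A B : obj C) (f : hom A B), le f f;
  le_trans : forall (A B : obj C) (f g h : hom A B),
    le f g -> le g h -> le f h;
  le_anti : forall (A B : obj C) (f g : hom A B), le f g -> le g f -> f = g;
  sup_ub : forall (A B : obj C) (S : set (hom A B)) (f : hom A B),
    S f -> le f (sup S);
  sup_le : forall (A B : obj C) (S : set (hom A B)) (g : hom A B),
    (forall f, S f -> le f g) -> le (sup S) g;
  comp_supl : forall (A B D : obj C) (S : set (hom B D)) (f : hom A B),
    sup S \o f = sup [set g \o f | g in S];
  comp_supr : forall (A B D : obj C) (g : hom B D) (S : set (hom A B)),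
    g \o sup S = sup [set g \o f | f in S];
  tens_supl : forall (A B D E : obj C) (S : set (hom A D)) (g : hom B E),
    sup S \oxm g = sup [set f \oxm g | f in S];
  tens_supr : forall (A B D E : obj C) (f : hom A D) (S : set (hom B E)),
    f \oxm sup S = sup [set f \oxm g | g in S];
  dag_sup : forall (A B : obj C) (S : set (hom A B)),
    (sup S)^dag = sup [set f^dag | f in S] }.

Record edcc := Edcc {
  edcc_sort :> edcc_data;
  edcc_category : is_category edcc_sort;
  edcc_dagger : is_dagger edcc_sort;
  edcc_monoidal : is_dagger_symmetric_monoidal edcc_sort;
  edcc_compact : is_compact edcc_sort;
  edcc_sup : is_sup_enriched edcc_sort }.

(* A morphism bundled with its endpoints: [Arrow f = Arrow g] says that f and g
   have equal domains, equal codomains, and are equal over these equalities. *)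
Record arrow (C : edcc_data) := Arrow {
  arrow_dom : obj C;
  arrow_cod : obj C;
  arrow_hom : hom arrow_dom arrow_cod }.

(* Functors preserving all the structure on the nose. *)
Record edcc_functor (C D : edcc_data) := EdccFunctor {
  fobj :> obj C -> obj D;
  fmap : forall A B : obj C, hom A B -> hom (fobj A) (fobj B);
  fmap_id : forall A : obj C, fmap (idm A) = idm (fobj A);
  fmap_comp : forall (A B E : obj C) (g : hom B E) (f : hom A B),
    fmap (g \o f) = fmap g \o fmap f;
  fobj_unit : fobj unit_obj = unit_obj;
  fobj_tens : forall A B : obj C, fobj (A \ox B) = fobj A \ox fobj B;
  fobj_dual : forall A : obj C, fobj (dual A) = dual (fobj A);
  fmap_tens : forall (A B E F : obj C) (f : hom A E) (g : hom B F),
    Arrow (fmap (f \oxm g)) = Arrow (fmap f \oxm fmap g);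
  fmap_assoc : forall A B E : obj C,
    Arrow (fmap (assoc A B E)) = Arrow (assoc (fobj A) (fobj B) (fobj E));
  fmap_lunit : forall A : obj C,
    Arrow (fmap (lunit A)) = Arrow (lunit (fobj A));
  fmap_runit : forall A : obj C,
    Arrow (fmap (runit A)) = Arrow (runit (fobj A));
  fmap_sym : forall A B : obj C,
    Arrow (fmap (sym A B)) = Arrow (sym (fobj A) (fobj B));
  fmap_dag : forall (A B : obj C) (f : hom A B), fmap f^dag = (fmap f)^dag;
  fmap_cup : forall A : obj C, Arrow (fmap (cup A)) = Arrow (cup (fobj A));
  fmap_cap : forall A : obj C, Arrow (fmap (cap A)) = Arrow (cap (fobj A));
  fmap_le : forall (A B : obj C) (f g : hom A B),
    le f g -> le (fmap f) (fmap g);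
  fmap_sup : forall (A B : obj C) (S : set (hom A B)),
    fmap (sup S) = sup [set fmap f | f in S] }.

Definition edcc_isomorphic (C D : edcc) : Prop :=
  exists (F : edcc_functor C D) (G : edcc_functor D C),
    [/\ (forall A : obj C, G (F A) = A),
        (forall (A B : obj C) (f : hom A B), Arrow (fmap G (fmap F f)) = Arrow f),
        (forall A : obj D, F (G A) = A) &
        (forall (A B : obj D) (f : hom A B), Arrow (fmap F (fmap G f)) = Arrow f)].

Local Close Scope edcc_scope.
Local Open Scope relation_scope.

(* The objects: both categories below have the same class of sets. *)
Definition sets := Type.

(* A relation from X to Y is a set (X * Y); composition [S \; R] (R first) and
   converse [R^-1] are those of classical_sets. *)

Definition rel_tens A B C D (R : set (A * C)) (S : set (B * D)) :
    set ((A * B) * (C * D)) :=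
  [set p | R (p.1.1, p.2.1) /\ S (p.1.2, p.2.2)].

Definition rel_graph X Y (f : X -> Y) : set (X * Y) := [set p | f p.1 = p.2].

Definition rel_assoc A B C : set (((A * B) * C) * (A * (B * C))) :=
  rel_graph (fun p => (p.1.1, (p.1.2, p.2))).
Definition rel_lunit A : set ((unit * A) * A) := rel_graph (fun p => p.2).
Definition rel_runit A : set ((A * unit) * A) := rel_graph (fun p => p.1).
Definition rel_sym A B : set ((A * B) * (B * A)) :=
  rel_graph (fun p => (p.2, p.1)).
Definition rel_cup A : set (unit * (A * A)) := [set p | p.2.1 = p.2.2].

Definition positive (X : Type) (P : set (X * X)) : Prop :=
  exists (Y : Type) (T : set (X * Y)), P = T^-1 \; T.

Definition cpm_bar A B (R : set ((A * A) * (B * B))) : set ((A * B) * (A * B)) :=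
  [set p | let: ((a1, b1), (a2, b2)) := p in R ((a2, a1), (b2, b1))].

Record cpm (A B : Type) := Cpm {
  cpm_rel : set ((A * A) * (B * B));
  cpm_pos : positive (cpm_bar cpm_rel) }.

Lemma cpm_ext A B (R S : cpm A B) :
  (forall a a' b b', 
    cpm_rel R ((a, a'), (b, b')) <-> cpm_rel S ((a, a'), (b, b'))) -> R = S.
Proof.
case: R S => [R hR] [S hS] /= RS.
have E : R = S by apply/predeqP => -[[a a'] [b b']].
by case: _ / E hS => hS; congr Cpm.
Qed.

Lemma positiveP (X : Type) (P : set (X * X)) :
  positive P <->
  (forall x y, P (x, y) -> P (y, x)) /\ (forall x y, P (x, y) -> P (x, x)).
Proof.
split=> [[Y [T ->]]|[Ps Pr]].
  by split=> x y [z /= xz yz]; exists z.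
exists (X * X)%type, [set p | P p.2 /\ (p.1 = p.2.1 \/ p.1 = p.2.2)].
apply/predeqP => -[x y]; split=> /= [Pxy|[[u v] /= [Puv xuv] [_ yuv]]].
  by exists (x, y) => /=; split=> //; [left|right].
case: xuv yuv => -> [] -> //; [exact: Pr Puv|exact: Ps|exact/Pr/Ps/Puv].
Qed.

Lemma cpmP A B (R : set ((A * A) * (B * B))) :
  positive (cpm_bar R) <->
  (forall a a' b b', R ((a, a'), (b, b')) -> R ((a', a), (b', b))) /\
  (forall a a' b b', R ((a, a'), (b, b')) -> R ((a, a), (b, b))).
Proof.
rewrite positiveP; split=> -[Rs Rr]; split.
- by move=> a a' b b'; apply: (Rs (a', b') (a, b)).
- by move=> a a' b b' r; apply: (Rr (a, b) (a', b')); apply: (Rs (a', b') (a, b)).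
- by move=> [a b] [a' b']; apply: Rs.
- by move=> [a b] [a' b'] r; apply: (Rr _ a' _ b'); apply: Rs.
Qed.

Lemma cpmC A B (R : cpm A B) a a' b b' :
  cpm_rel R ((a, a'), (b, b')) -> cpm_rel R ((a', a), (b', b)).
Proof. by have [+ _] := (cpmP _).1 (cpm_pos R); apply. Qed.

Lemma cpmD A B (R : cpm A B) a a' b b' :
  cpm_rel R ((a, a'), (b, b')) -> cpm_rel R ((a, a), (b, b)).
Proof. by have [_ +] := (cpmP _).1 (cpm_pos R); apply. Qed.

Lemma cpm_pure_subproof A B (h : set (A * B)) :
  positive (cpm_bar (rel_tens h h)).
Proof. by apply/cpmP; split=> a a' b b' []. Qed.

(* The image h (x) h of a relation h. *)
Definition cpm_pure A B (h : set (A * B)) : cpm A B :=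
  Cpm (cpm_pure_subproof h).

Lemma cpm_comp_subproof A B C (S : cpm B C) (R : cpm A B) :
  positive (cpm_bar (cpm_rel S \; cpm_rel R)).
Proof.
apply/cpmP; split=> a a' c c' [[b b'] /= Rb Sb].
  by exists (b', b); apply: cpmC.
by exists (b, b); [apply: cpmD Rb|apply: cpmD Sb].
Qed.

Definition cpm_comp A B C (S : cpm B C) (R : cpm A B) : cpm A C :=
  Cpm (cpm_comp_subproof S R).

Lemma cpm_tens_subproof A B C D (R : cpm A C) (S : cpm B D) :
  positive (cpm_bar [set p | let: (((a, b), (a', b')), ((c, d), (c', d'))) := p in
    cpm_rel R ((a, a'), (c, c')) /\ cpm_rel S ((b, b'), (d, d'))]).
Proof.
apply/cpmP; split=> -[a b] [a' b'] [c d] [c' d'] /= [Ra Sb].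
  by split; apply: cpmC.
by split; [apply: cpmD Ra|apply: cpmD Sb].
Qed.

Definition cpm_tens A B C D (R : cpm A C) (S : cpm B D) :
    cpm (A * B) (C * D) :=
  Cpm (cpm_tens_subproof R S).

Lemma cpm_dag_subproof A B (R : cpm A B) : positive (cpm_bar (cpm_rel R)^-1).
Proof.
apply/cpmP; split=> a a' b b' /= Rb; first exact: cpmC.
exact: cpmD Rb.
Qed.

Definition cpm_dag A B (R : cpm A B) : cpm B A := Cpm (cpm_dag_subproof R).

Lemma cpm_sup_subproof A B (F : set (cpm A B)) :
  positive (cpm_bar (\bigcup_(R in F) cpm_rel R)).
Proof.
by apply/cpmP; split=> a a' b b' [R FR Rab];
  exists R => //; [apply: cpmC|apply: cpmD Rab].
Qed.

Definition cpm_sup A B (F : set (cpm A B)) : cpm A B :=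
  Cpm (cpm_sup_subproof F).

Definition CPMRel_data : edcc_data := {|
  obj := sets;
  hom := cpm;
  idm := fun A => cpm_pure (@diagonal A);
  comp := cpm_comp;
  unit_obj := unit;
  tens := fun A B => (A * B)%type;
  tensm := cpm_tens;
  assoc := fun A B C => cpm_pure (@rel_assoc A B C);
  lunit := fun A => cpm_pure (@rel_lunit A);
  runit := fun A => cpm_pure (@rel_runit A);
  sym := fun A B => cpm_pure (@rel_sym A B);
  dag := cpm_dag;
  dual := fun A => A;
  cup := fun A => cpm_pure (@rel_cup A);
  cap := fun A => cpm_pure (@rel_cup A)^-1;
  le := fun A B R S => cpm_rel R `<=` cpm_rel S;
  sup := cpm_sup |}.

(* A graph whose vertex set is a subset of X. An unordered pair {v, w} is the
   set [set v; w]; thus {v} is the pair with v = w. *)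
Record graph (X : Type) := Graph {
  vert : set X;
  edge : set (set X);
  edge_pair : forall e, edge e ->
    exists v w, [/\ vert v, vert w & e = [set v; w]];
  edge_loop : forall v, vert v -> edge [set v] }.

Arguments edge_pair {X g e} _.
Arguments edge_loop {X g v} _.

Lemma pair_set_eq X (v w v' w' : X) : [set v; w] = [set v'; w'] ->
  (v = v' /\ w = w') \/ (v = w' /\ w = v').
Proof.
move=> E.
have Ev : [set v'; w'] v by rewrite -E; left.
have Ew : [set v'; w'] w by rewrite -E; right.
have Ev' : [set v; w] v' by rewrite E; left.
have Ew' : [set v; w] w' by rewrite E; right.
clear E; simpl in *.
by case: Ev => ?; case: Ew => ?; case: Ev' => ?; case: Ew' => ?; subst; tauto.
Qed.

Arguments pair_set_eq {X v w v' w'} _.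

Lemma edgeC X (g : graph X) v w : edge g [set v; w] -> edge g [set w; v].
Proof. by rewrite setUC. Qed.

Lemma edge_vert X (g : graph X) v w :
  edge g [set v; w] -> vert g v /\ vert g w.
Proof.
move=> gvw; have [x [y [gx gy e]]] := edge_pair gvw.
by case: (pair_set_eq e) => -[-> ->].
Qed.

Arguments edge_vert {X g v w} _.

Lemma vertE X (g : graph X) v : vert g v <-> edge g [set v; v].
Proof.
by split=> [gv|/edge_vert[]//]; rewrite setUid; apply: edge_loop.
Qed.

Lemma graph_ext X (g h : graph X) :
  (forall v w, edge g [set v; w] <-> edge h [set v; w]) -> g = h.
Proof.
move=> gh.
have Ev : vert g = vert h by apply/predeqP => v; rewrite !vertE gh.
have Ee : edge g = edge h.
  by apply/predeqP => e; split=> ge; have [v [w [_ _ e_eq]]] := edge_pair ge;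
    move: ge; rewrite e_eq gh.
case: g h Ev Ee {gh} => [V E p l] [V' E' p' l'] /= Ev Ee.
by case: _ / Ev p' l' => p' l'; case: _ / Ee p' l' => p' l'; congr Graph.
Qed.

Section Complete.
Variables (X : Type) (W : set X).
Let E := [set e | exists v w, [/\ W v, W w & e = [set v; w]]].
Fact complete_pair e : E e -> exists v w, [/\ W v, W w & e = [set v; w]].
Proof. by []. Qed.
Fact complete_loop v : W v -> E [set v].
Proof. by move=> Wv; exists v, v; rewrite setUid. Qed.
Definition complete_graph : graph X := Graph complete_pair complete_loop.
End Complete.

Section Compose.
Variables (A B C : Type) (g' : graph (B * C)) (g : graph (A * B)).
Let V := vert g' \; vert g.
Let E := [set e | exists a c a' c',
  (exists b b', edge g [set (a, b); (a', b')] /\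
                edge g' [set (b, c); (b', c')]) /\
  e = [set (a, c); (a', c')]].
Fact gcomp_pair e : E e -> exists v w, [/\ V v, V w & e = [set v; w]].
Proof.
move=> [a [c [a' [c' [[b [b' [/edge_vert[? ?] /edge_vert[? ?]]]] ->]]]]].
by exists (a, c), (a', c'); split=> //; [exists b|exists b'].
Qed.
Fact gcomp_loop v : V v -> E [set v].
Proof.
case: v => a c [b /= /edge_loop gab /edge_loop g'bc].
by exists a, c, a, c; rewrite setUid; split=> //; exists b, b; rewrite !setUid.
Qed.
Definition gcomp : graph (A * C) := Graph gcomp_pair gcomp_loop.
End Compose.

Section Tensor.
Variables (A B C D : Type) (g : graph (A * C)) (g' : graph (B * D)).
Let V := rel_tens (vert g) (vert g').
Let E := [set e | exists a b c d a' b' c' d',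
  [/\ edge g [set (a, c); (a', c')], edge g' [set (b, d); (b', d')] &
      e = [set ((a, b), (c, d)); ((a', b'), (c', d'))]]].
Fact gtens_pair e : E e -> exists v w, [/\ V v, V w & e = [set v; w]].
Proof.
move=> [a [b [c [d [a' [b' [c' [d' [/edge_vert[? ?] /edge_vert[? ?] ->]]]]]]]]].
by exists ((a, b), (c, d)), ((a', b'), (c', d')).
Qed.
Fact gtens_loop v : V v -> E [set v].
Proof.
case: v => -[a b] [c d] [/= /edge_loop gac /edge_loop g'bd].
by exists a, b, c, d, a, b, c, d; rewrite !setUid.
Qed.
Definition gtens : graph ((A * B) * (C * D)) := Graph gtens_pair gtens_loop.
End Tensor.

Section Dagger.
Variables (A B : Type) (g : graph (A * B)).
Let V := (vert g)^-1.
Let E := [set e | exists a b a' b',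
  edge g [set (a, b); (a', b')] /\ e = [set (b, a); (b', a')]].
Fact gdag_pair e : E e -> exists v w, [/\ V v, V w & e = [set v; w]].
Proof.
move=> [a [b [a' [b' [/edge_vert[? ?] ->]]]]].
by exists (b, a), (b', a').
Qed.
Fact gdag_loop v : V v -> E [set v].
Proof.
by case: v => b a /edge_loop gab; exists a, b, a, b; rewrite !setUid.
Qed.
Definition gdag : graph (B * A) := Graph gdag_pair gdag_loop.
End Dagger.

Section Join.
Variables (X : Type) (F : set (graph X)).
Let V := \bigcup_(g in F) vert g.
Let E := \bigcup_(g in F) edge g.
Fact gsup_pair e : E e -> exists v w, [/\ V v, V w & e = [set v; w]].
Proof.
case=> g Fg /edge_pair[v [w [gv gw ->]]].
by exists v, w; split=> //; exists g.
Qed.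
Fact gsup_loop v : V v -> E [set v].
Proof. by case=> g Fg /edge_loop ge; exists g. Qed.
Definition gsup : graph X := Graph gsup_pair gsup_loop.
End Join.

Definition Gr_data : edcc_data := {|
  obj := sets;
  hom := fun A B => graph (A * B);
  idm := fun A => complete_graph (@diagonal A);
  comp := gcomp;
  unit_obj := unit;
  tens := fun A B => (A * B)%type;
  tensm := gtens;
  assoc := fun A B C => complete_graph (@rel_assoc A B C);
  lunit := fun A => complete_graph (@rel_lunit A);
  runit := fun A => complete_graph (@rel_runit A);
  sym := fun A B => complete_graph (@rel_sym A B);
  dag := gdag;
  dual := fun A => A;
  cup := fun A => complete_graph (@rel_cup A);
  cap := fun A => gdag (complete_graph (@rel_cup A));
  le := fun A B g g' => edge g `<=` edge g';
  sup := fun A B => @gsup (A * B) |}.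

Ltac rel_simpl :=
  simpl in *;
  unfold rel_tens, rel_assoc, rel_lunit, rel_runit, rel_sym, rel_cup,
    rel_graph, diagonal in *;
  simpl in *.

(* Open evars for the components of a tuple type. *)
Ltac tuple_evar T :=
  lazymatch T with
  | prod ?A ?B =>
      let a := tuple_evar A in let b := tuple_evar B in constr:((a, b))
  | unit => constr:(tt)
  | _ => open_constr:(_ : T)
  end.

Ltac break_hyps :=
  repeat (rel_simpl; match goal with
  | x : unit |- _ => destruct x
  | x : prod _ _ |- _ => destruct x
  | H : ex _ |- _ => destruct H
  | H : ex2 _ _ |- _ => destruct H
  | H : and _ _ |- _ => destruct H
  | H : and3 _ _ _ |- _ => destruct H
  | H : pair _ _ = pair _ _ |- _ => injection H; clear H; intros
  | H : _ = _ |- _ => progress subst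
  end).

Ltac build_goal :=
  repeat (rel_simpl; match goal with
  | |- ex2 (A := ?T) _ _ => let t := tuple_evar T in exists t
  | |- ex (A := ?T) _ => let t := tuple_evar T in exists t
  | |- and _ _ => split
  end).

Ltac rel_solve :=
  split; intros; break_hyps; build_goal;
  once (multimatch goal with
        | H : _ |- _ => exact H
        | |- _ = _ => reflexivity
        | H : _ = _ |- _ => symmetry; exact H
        | |- True => exact I
        end).

Section RelLaws.

Local Notation "f (x) g" := (rel_tens f g) (at level 40).
Local Notation I A := (@diagonal A).
Local Notation asc A B C := (@rel_assoc A B C).

Ltac rel_law := apply/predeqP => p; rel_solve.

Lemma rel_tens1 A B : I A (x) I B = I (A * B).
Proof. rel_law. Qed.
Lemma rel_assocK A B C : (asc A B C)^-1 \; asc A B C = I _.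
Proof. rel_law. Qed.
Lemma rel_assocVK A B C : asc A B C \; (asc A B C)^-1 = I _.
Proof. rel_law. Qed.
Lemma rel_lunitK A : (@rel_lunit A)^-1 \; @rel_lunit A = I _.
Proof. rel_law. Qed.
Lemma rel_lunitVK A : @rel_lunit A \; (@rel_lunit A)^-1 = I _.
Proof. rel_law. Qed.
Lemma rel_runitK A : (@rel_runit A)^-1 \; @rel_runit A = I _.
Proof. rel_law. Qed.
Lemma rel_runitVK A : @rel_runit A \; (@rel_runit A)^-1 = I _.
Proof. rel_law. Qed.
Lemma rel_symK A B : @rel_sym B A \; @rel_sym A B = I _.
Proof. rel_law. Qed.
Lemma rel_sym_inv A B : (@rel_sym A B)^-1 = @rel_sym B A.
Proof. rel_law. Qed.
Lemma rel_diag_inv A : (I A)^-1 = I A.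
Proof. rel_law. Qed.
Lemma rel_pentagon A B C D :
  asc A B (C * D) \; asc (A * B) C D
  = (I A (x) asc B C D) \; (asc A (B * C) D \; (asc A B C (x) I D)).
Proof. rel_law. Qed.
Lemma rel_triangle A B :
  (I A (x) @rel_lunit B) \; asc A unit B = @rel_runit A (x) I B.
Proof. rel_law. Qed.
Lemma rel_hexagon A B C :
  asc B C A \; (@rel_sym A (B * C) \; asc A B C)
  = (I B (x) @rel_sym A C) \; (asc B A C \; (@rel_sym A B (x) I C)).
Proof. rel_law. Qed.
Lemma rel_cap_sym A : (@rel_cup A)^-1 = (@rel_cup A)^-1 \; @rel_sym A A.
Proof. rel_law. Qed.
Lemma rel_snake A :
  @rel_lunit A \; (((@rel_cup A)^-1 (x) I A) \; ((asc A A A)^-1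
    \; ((I A (x) @rel_cup A) \; (@rel_runit A)^-1))) = I A.
Proof. rel_law. Qed.
Lemma rel_snake_dual A :
  @rel_runit A \; ((I A (x) (@rel_cup A)^-1) \; (asc A A A
    \; ((@rel_cup A (x) I A) \; (@rel_lunit A)^-1))) = I A.
Proof. rel_law. Qed.

End RelLaws.

Lemma cpm_pure_comp A B C (k : set (B * C)) (h : set (A * B)) :
  cpm_comp (cpm_pure k) (cpm_pure h) = cpm_pure (k \; h).
Proof. by apply: cpm_ext => *; rel_solve. Qed.

Lemma cpm_pure_tens A B C D (h : set (A * C)) (k : set (B * D)) :
  cpm_tens (cpm_pure h) (cpm_pure k) = cpm_pure (rel_tens h k).
Proof. by apply: cpm_ext => *; rel_solve. Qed.

Lemma cpm_pure_dag A B (h : set (A * B)) :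
  cpm_dag (cpm_pure h) = cpm_pure h^-1.
Proof. by apply: cpm_ext. Qed.

Ltac cpm_law := intros; apply: cpm_ext => *; rel_solve.
Ltac cpm_pure_law lem :=
  intros; rewrite /= ?(cpm_pure_tens, cpm_pure_dag, cpm_pure_comp);
  congr cpm_pure; apply: lem.

Lemma CPMRel_category : is_category CPMRel_data.
Proof. by split; cpm_law. Qed.

Lemma CPMRel_dagger : is_dagger CPMRel_data.
Proof. by split; cpm_law. Qed.

Lemma CPMRel_monoidal : is_dagger_symmetric_monoidal CPMRel_data.
Proof.
split.
- cpm_pure_law rel_tens1.
- cpm_law.
- cpm_law.
- cpm_law.
- cpm_law.
- cpm_law.
- cpm_law.
- cpm_pure_law rel_assocK.
- cpm_pure_law rel_assocVK.
- cpm_pure_law rel_lunitK.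
- cpm_pure_law rel_lunitVK.
- cpm_pure_law rel_runitK.
- cpm_pure_law rel_runitVK.
- cpm_pure_law rel_symK.
- cpm_pure_law rel_sym_inv.
- cpm_pure_law rel_pentagon.
- cpm_pure_law rel_triangle.
- cpm_pure_law rel_hexagon.
Qed.

Lemma CPMRel_compact : is_compact CPMRel_data.
Proof.
split.
- cpm_pure_law rel_cap_sym.
- cpm_pure_law rel_snake.
- cpm_pure_law rel_snake_dual.
Qed.

Lemma CPMRel_sup : is_sup_enriched CPMRel_data.
Proof.
split=> /=.
- by move=> A B f; apply: subset_refl.
- by move=> A B f g h; apply: subset_trans.
- by move=> A B f g fg gf; apply: cpm_ext => *; split; [apply: fg|apply: gf].
- by move=> A B S f Sf; apply: bigcup_sup.
- by move=> A B S g Sg; apply: bigcup_sub.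
- move=> A B D S f; apply: cpm_ext => a a' d d' /=; split.
    move=> [b fb [g Sg gd]]; exists (cpm_comp g f); first by exists g.
    by exists b.
  by move=> [_ [g Sg <-] [b fb gd]]; exists b => //; exists g.
- move=> A B D g S; apply: cpm_ext => a a' d d' /=; split.
    move=> [b [f Sf fb] gd]; exists (cpm_comp g f); first by exists f.
    by exists b.
  by move=> [_ [f Sf <-] [b fb gd]]; exists b => //; exists f.
- move=> A B D E S g; apply: cpm_ext => -[a b] [a' b'] [d e] [d' e'] /=; split.
    by move=> [[f Sf fa] gb]; exists (cpm_tens f g) => //; exists f.
  by move=> [_ [f Sf <-] [fa gb]]; split=> //; exists f.
- move=> A B D E f S; apply: cpm_ext => -[a b] [a' b'] [d e] [d' e'] /=; split.
    by move=> [fa [g Sg gb]]; exists (cpm_tens f g) => //; exists g.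
  by move=> [_ [g Sg <-] [fa gb]]; split=> //; exists g.
- move=> A B S; apply: cpm_ext => a a' b b' /=; split.
    by move=> [f Sf fa]; exists (cpm_dag f) => //; exists f.
  by move=> [_ [f Sf <-] fa]; exists f.
Qed.

Definition CPMRel : edcc :=
  Edcc CPMRel_category CPMRel_dagger CPMRel_monoidal CPMRel_compact CPMRel_sup.

Lemma edge_complete X (W : set X) v w :
  edge (complete_graph W) [set v; w] <-> W v /\ W w.
Proof.
split=> [|[Wv Ww]]; last by exists v, w.
by move=> [x [y [Wx Wy /pair_set_eq[[-> ->]|[-> ->]]]]].
Qed.

Lemma edge_comp A B C (g' : graph (B * C)) (g : graph (A * B)) a c a' c' :
  edge (gcomp g' g) [set (a, c); (a', c')] <->
  exists b b', edge g [set (a, b); (a', b')] /\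
               edge g' [set (b, c); (b', c')].
Proof.
split=> [|h]; last by exists a, c, a', c'.
move=> [x [z [x' [z' [[b [b' [gb g'b]]] /pair_set_eq]]]]].
case=> -[[-> ->] [-> ->]]; first by exists b, b'.
by exists b', b; split; apply: edgeC.
Qed.

Lemma edge_tens A B C D (g : graph (A * C)) (g' : graph (B * D))
    a b c d a' b' c' d' :
  edge (gtens g g') [set ((a, b), (c, d)); ((a', b'), (c', d'))] <->
  edge g [set (a, c); (a', c')] /\ edge g' [set (b, d); (b', d')].
Proof.
split=> [|[h h']]; last by exists a, b, c, d, a', b', c', d'.
move=> [x [y [z [t [x' [y' [z' [t' [h h' /pair_set_eq]]]]]]]]].
case=> -[[-> -> -> ->] [-> -> -> ->]] //.
by split; apply: edgeC.
Qed.

Lemma edge_dag A B (g : graph (A * B)) a b a' b' :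
  edge (gdag g) [set (b, a); (b', a')] <-> edge g [set (a, b); (a', b')].
Proof.
split=> [|h]; last by exists a, b, a', b'.
move=> [x [y [x' [y' [h /pair_set_eq]]]]].
by case=> -[[-> ->] [-> ->]] //; apply: edgeC.
Qed.

Lemma complete_comp A B C (k : set (B * C)) (h : set (A * B)) :
  gcomp (complete_graph k) (complete_graph h) = complete_graph (k \; h).
Proof.
apply: graph_ext => -[a c] [a' c']; rewrite edge_comp edge_complete.
split=> [[b [b' [/edge_complete[? ?] /edge_complete[? ?]]]]|].
  by split; [exists b|exists b'].
by move=> [[b /= ? ?] [b' /= ? ?]]; exists b, b'; split; apply/edge_complete.
Qed.

Lemma complete_tens A B C D (h : set (A * C)) (k : set (B * D)) :
  gtens (complete_graph h) (complete_graph k) = complete_graph (rel_tens h k).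
Proof.
apply: graph_ext => -[[a b] [c d]] [[a' b'] [c' d']].
by rewrite edge_tens !edge_complete /rel_tens /=; tauto.
Qed.

Lemma complete_dag A B (h : set (A * B)) :
  gdag (complete_graph h) = complete_graph h^-1.
Proof.
by apply: graph_ext => -[b a] [b' a']; rewrite edge_dag !edge_complete.
Qed.

#[local] Arguments edge : simpl never.

Ltac break_edges :=
  repeat (break_hyps; match goal with
  | H : edge (gcomp _ _) _ |- _ => apply (iffLR (edge_comp _ _ _ _ _ _)) in H
  | H : edge (gtens _ _) _ |- _ => apply (iffLR (edge_tens _ _ _ _ _ _ _ _ _ _)) in H
  | H : edge (gdag _) _ |- _ => apply (iffLR (edge_dag _ _ _ _ _)) in H
  | H : edge (complete_graph _) _ |- _ => apply (iffLR (edge_complete _ _ _)) in H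
  end); break_hyps.

Ltac build_edges :=
  build_goal;
  lazymatch goal with
  | |- edge (gcomp _ _) _ => apply (iffRL (edge_comp _ _ _ _ _ _)); build_edges
  | |- edge (gtens _ _) _ => apply (iffRL (edge_tens _ _ _ _ _ _ _ _ _ _)); build_edges
  | |- edge (gdag _) _ => apply (iffRL (edge_dag _ _ _ _ _)); build_edges
  | |- edge (complete_graph _) _ => apply (iffRL (edge_complete _ _ _)); build_edges
  | |- _ => idtac
  end.

Ltac edge_law :=
  intros; apply: graph_ext => v w;
  split; intros; break_edges; build_edges;
  once (multimatch goal with
        | H : _ |- _ => exact H
        | |- _ = _ => reflexivity
        end).

Ltac complete_law lem :=
  intros; rewrite /= ?(complete_tens, complete_dag, complete_comp);
  congr complete_graph; apply: lem.

Lemma Gr_category : is_category Gr_data.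
Proof. by split; edge_law. Qed.

Lemma Gr_dagger : is_dagger Gr_data.
Proof. by split; edge_law. Qed.

Lemma Gr_monoidal : is_dagger_symmetric_monoidal Gr_data.
Proof.
split.
- complete_law rel_tens1.
- edge_law.
- edge_law.
- edge_law.
- edge_law.
- edge_law.
- edge_law.
- complete_law rel_assocK.
- complete_law rel_assocVK.
- complete_law rel_lunitK.
- complete_law rel_lunitVK.
- complete_law rel_runitK.
- complete_law rel_runitVK.
- complete_law rel_symK.
- complete_law rel_sym_inv.
- complete_law rel_pentagon.
- complete_law rel_triangle.
- complete_law rel_hexagon.
Qed.

Lemma Gr_compact : is_compact Gr_data.
Proof.
split.
- complete_law rel_cap_sym.
- complete_law rel_snake.
- complete_law rel_snake_dual.
Qed.

Lemma Gr_sup : is_sup_enriched Gr_data.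
Proof.
split=> /=.
- by move=> A B f; apply: subset_refl.
- by move=> A B f g h; apply: subset_trans.
- by move=> A B f g fg gf; apply: graph_ext => *; split; [apply: fg|apply: gf].
- by move=> A B S f Sf; apply: bigcup_sup.
- by move=> A B S g Sg; apply: bigcup_sub.
- move=> A B D S f; apply: graph_ext => -[a d] [a' d']; rewrite edge_comp; split.
    move=> [b [b' [fb [g Sg gd]]]]; exists (gcomp g f); first by exists g.
    by apply/edge_comp; exists b, b'.
  move=> [_ [g Sg <-] /edge_comp[b [b' [fb gd]]]].
  by exists b, b'; split=> //; exists g.
- move=> A B D g S; apply: graph_ext => -[a d] [a' d']; rewrite edge_comp; split.
    move=> [b [b' [[f Sf fb] gd]]]; exists (gcomp g f); first by exists f.
    by apply/edge_comp; exists b, b'.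
  move=> [_ [f Sf <-] /edge_comp[b [b' [fb gd]]]].
  by exists b, b'; split=> //; exists f.
- move=> A B D E S g; apply: graph_ext => -[[a b] [d e]] [[a' b'] [d' e']].
  rewrite edge_tens; split.
    move=> [[f Sf fa] gb]; exists (gtens f g); first by exists f.
    exact/edge_tens.
  by move=> [_ [f Sf <-] /edge_tens[fa gb]]; split=> //; exists f.
- move=> A B D E f S; apply: graph_ext => -[[a b] [d e]] [[a' b'] [d' e']].
  rewrite edge_tens; split.
    move=> [fa [g Sg gb]]; exists (gtens f g); first by exists g.
    exact/edge_tens.
  by move=> [_ [g Sg <-] /edge_tens[fa gb]]; split=> //; exists g.
- move=> A B S; apply: graph_ext => -[b a] [b' a']; rewrite edge_dag; split.
    move=> [f Sf fa]; exists (gdag f); first by exists f.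
    exact/edge_dag.
  by move=> [_ [f Sf <-] /edge_dag fa]; exists f.
Qed.

Definition Gr : edcc :=
  Edcc Gr_category Gr_dagger Gr_monoidal Gr_compact Gr_sup.

(* Main.v *)
From mathcomp Require Import all_boot.
From mathcomp Require Import boolp classical_sets.
Require Import Defs.

(* A morphism R of CPM(Rel) is determined by the relation [R ((a, a'), (b, b'))]
   between the pairs (a, b) and (a', b'). Complete positivity says precisely
   that this relation is symmetric and reflexive on the pairs it involves, i.e.
   that it is the adjacency relation of a graph with a loop at every vertex. On
   both sides the structure is computed pointwise by the same formulas. *)

Set Implicit Arguments.
Unset Strict Implicit.
Unset Printing Implicit Defensive.

Local Open Scope classical_set_scope.

Section GraphOfCpm.
Variables (A B : Type) (R : cpm A B).
Let V : set (A * B) := [set v | cpm_rel R ((v.1, v.1), (v.2, v.2))].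
Let E : set (set (A * B)) := [set e | exists a b a' b',
  cpm_rel R ((a, a'), (b, b')) /\ e = [set (a, b); (a', b')]].

Fact graph_of_cpm_pair e : E e -> exists v w, [/\ V v, V w & e = [set v; w]].
Proof.
move=> [a [b [a' [b' [Rab ->]]]]]; exists (a, b), (a', b'); split=> //.
  exact: cpmD Rab.
exact: cpmD (cpmC Rab).
Qed.

Fact graph_of_cpm_loop v : V v -> E [set v].
Proof. by case: v => a b Vab; exists a, b, a, b; rewrite setUid. Qed.

Definition graph_of_cpm : graph (A * B) :=
  Graph graph_of_cpm_pair graph_of_cpm_loop.

(** An unordered pair can be listed in two orders; the symmetry [cpmC] makes both readings agree, so
    passing to sets of endpoints loses nothing of [R]. *)
Lemma edge_graph_of_cpm a b a' b' :
  edge graph_of_cpm [set (a, b); (a', b')] <-> cpm_rel R ((a, a'), (b, b')).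
Proof.
split=> [|Rab]; last by exists a, b, a', b'.
move=> [x [y [x' [y' [Rxy /pair_set_eq]]]]].
by case=> -[[-> ->] [-> ->]] //; apply: cpmC.
Qed.
End GraphOfCpm.

(** By [cpmP], positivity splits in two: symmetry holds because edges are unordered, and the
    diagonal condition because endpoints of edges are vertices and carry loops. *)
Lemma cpm_of_graph_subproof A B (g : graph (A * B)) :
  positive (cpm_bar [set p | edge g [set (p.1.1, p.2.1); (p.1.2, p.2.2)]]).
Proof.
apply/cpmP; split=> a a' b b' /=; first exact: edgeC.
by move=> /edge_vert[gab _]; rewrite setUid; apply: edge_loop.
Qed.

Definition cpm_of_graph A B (g : graph (A * B)) : cpm A B :=
  Cpm (cpm_of_graph_subproof g).

Lemma graph_of_cpmK A B : cancel (@graph_of_cpm A B) (@cpm_of_graph A B).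
Proof. by move=> R; apply: cpm_ext => *; apply: edge_graph_of_cpm. Qed.

(** Comparing edges suffices: by [graph_ext] the loops determine the vertex set. *)
Lemma cpm_of_graphK A B : cancel (@cpm_of_graph A B) (@graph_of_cpm A B).
Proof.
by move=> g; apply: graph_ext => -[a b] [a' b']; rewrite edge_graph_of_cpm.
Qed.

(** Two points are adjacent in the complete graph on [h] exactly when both lie in [h], which is the
    relation [rel_tens h h]. This one fact transports identities, structural isomorphisms,
    symmetries and cups. *)
Lemma cpm_of_complete A B (h : set (A * B)) :
  cpm_of_graph (complete_graph h) = cpm_pure h.
Proof. by apply: cpm_ext => *; apply: edge_complete. Qed.

Lemma cpm_of_comp A B C (g : graph (B * C)) (f : graph (A * B)) :
  cpm_of_graph (gcomp g f) = cpm_comp (cpm_of_graph g) (cpm_of_graph f).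
Proof.
apply: cpm_ext => a a' c c'; apply: (iff_trans (edge_comp _ _ _ _ _ _)).
by split=> [[b [b' []]]|[[b b']]]; [exists (b, b')|exists b, b'].
Qed.

Lemma cpm_of_tens A B C D (f : graph (A * C)) (g : graph (B * D)) :
  cpm_of_graph (gtens f g) = cpm_tens (cpm_of_graph f) (cpm_of_graph g).
Proof. by apply: cpm_ext => -[a b] [a' b'] [c d] [c' d']; apply: edge_tens. Qed.

Lemma cpm_of_dag A B (g : graph (A * B)) :
  cpm_of_graph (gdag g) = cpm_dag (cpm_of_graph g).
Proof. by apply: cpm_ext => *; apply: edge_dag. Qed.

(** The cap needs its own lemma since it is a dagger in [Gr_data] but the image of a converse in
    [CPMRel_data]. *)
Lemma cpm_of_cap A :
  cpm_of_graph (gdag (complete_graph (@rel_cup A)))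
  = cpm_pure ((@rel_cup A)^-1)%relation.
Proof. by rewrite complete_dag cpm_of_complete. Qed.

Lemma cpm_of_sup A B (S : set (graph (A * B))) :
  cpm_of_graph (gsup S) = cpm_sup [set cpm_of_graph g | g in S].
Proof.
apply: cpm_ext => a a' b b'; split=> [[g Sg gab]|[_ [g Sg <-] gab]].
  by exists (cpm_of_graph g) => //; exists g.
by exists g.
Qed.

(** The inverse of a structure-preserving bijection preserves the structure, so [canLR] turns the
    law for [cpm_of_graph] into the one for [graph_of_cpm]; composition, tensor and dagger below go
    the same way. *)
Lemma graph_of_cpm_sup A B (S : set (cpm A B)) :
  graph_of_cpm (cpm_sup S) = gsup [set graph_of_cpm R | R in S].
Proof.
apply: (canLR (@cpm_of_graphK A B)); rewrite cpm_of_sup image_comp.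
(* The family has been mapped to graphs and back, so it is [S] again. *)
by under eq_imagel do rewrite /= graph_of_cpmK; rewrite image_id.
Qed.

Lemma graph_of_pure A B (h : set (A * B)) :
  graph_of_cpm (cpm_pure h) = complete_graph h.
Proof. by rewrite -cpm_of_complete cpm_of_graphK. Qed.

Lemma graph_of_cpm_comp A B C (S : cpm B C) (R : cpm A B) :
  graph_of_cpm (cpm_comp S R) = gcomp (graph_of_cpm S) (graph_of_cpm R).
Proof.
by apply: (canLR (@cpm_of_graphK A C)); rewrite cpm_of_comp !graph_of_cpmK.
Qed.

Lemma graph_of_cpm_tens A B C D (R : cpm A C) (S : cpm B D) :
  graph_of_cpm (cpm_tens R S) = gtens (graph_of_cpm R) (graph_of_cpm S).
Proof.
by apply: (canLR (@cpm_of_graphK _ _)); rewrite cpm_of_tens !graph_of_cpmK.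
Qed.

Lemma graph_of_cpm_dag A B (R : cpm A B) :
  graph_of_cpm (cpm_dag R) = gdag (graph_of_cpm R).
Proof.
by apply: (canLR (@cpm_of_graphK _ _)); rewrite cpm_of_dag graph_of_cpmK.
Qed.

Lemma graph_of_cap A :
  graph_of_cpm (cpm_pure ((@rel_cup A)^-1)%relation)
  = gdag (complete_graph (@rel_cup A)).
Proof. by rewrite -cpm_of_cap cpm_of_graphK. Qed.

Lemma graph_of_cpm_le A B (R S : cpm A B) :
  cpm_rel R `<=` cpm_rel S -> edge (graph_of_cpm R) `<=` edge (graph_of_cpm S).
Proof.
by move=> RS e [a [b [a' [b' [/RS Sab ->]]]]]; exists a, b, a', b'.
Qed.

Lemma cpm_of_graph_le A B (f g : graph (A * B)) :
  edge f `<=` edge g -> cpm_rel (cpm_of_graph f) `<=` cpm_rel (cpm_of_graph g).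
Proof. by move=> fg p; apply: fg. Qed.

(** As the functor is the identity on objects and both categories share their object operations,
    object equations are [erefl], and each equation of arrows comes by [congr1] from one inside a
    single homset. *)
Definition graph_functor : edcc_functor CPMRel Gr :=
  @EdccFunctor CPMRel Gr (fun A => A) graph_of_cpm
    (fun A => graph_of_pure _)
    graph_of_cpm_comp
    erefl (fun _ _ => erefl) (fun _ => erefl)
    (fun A B C D f g => congr1 (@Arrow Gr _ _) (graph_of_cpm_tens f g))
    (fun A B C => congr1 (@Arrow Gr _ _) (graph_of_pure _))
    (fun A => congr1 (@Arrow Gr _ _) (graph_of_pure _))
    (fun A => congr1 (@Arrow Gr _ _) (graph_of_pure _))
    (fun A B => congr1 (@Arrow Gr _ _) (graph_of_pure _))
    graph_of_cpm_dag
    (fun A => congr1 (@Arrow Gr _ _) (graph_of_pure _))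
    (fun A => congr1 (@Arrow Gr _ _) (graph_of_cap A))
    graph_of_cpm_le
    graph_of_cpm_sup.

Definition cpm_functor : edcc_functor Gr CPMRel :=
  @EdccFunctor Gr CPMRel (fun A => A) cpm_of_graph
    (fun A => cpm_of_complete _)
    cpm_of_comp
    erefl (fun _ _ => erefl) (fun _ => erefl)
    (fun A B C D f g => congr1 (@Arrow CPMRel _ _) (cpm_of_tens f g))
    (fun A B C => congr1 (@Arrow CPMRel _ _) (cpm_of_complete _))
    (fun A => congr1 (@Arrow CPMRel _ _) (cpm_of_complete _))
    (fun A => congr1 (@Arrow CPMRel _ _) (cpm_of_complete _))
    (fun A B => congr1 (@Arrow CPMRel _ _) (cpm_of_complete _))
    cpm_of_dag
    (fun A => congr1 (@Arrow CPMRel _ _) (cpm_of_complete _))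
    (fun A => congr1 (@Arrow CPMRel _ _) (cpm_of_cap A))
    cpm_of_graph_le
    cpm_of_sup.

Theorem theorem5p9 : edcc_isomorphic CPMRel Gr.
Proof.
exists graph_functor, cpm_functor; split=> // A B f.
  by congr Arrow; apply: graph_of_cpmK.
by congr Arrow; apply: cpm_of_graphK.
Qed.
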